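(* Let $\boldsymbol{g}^2=(g_0^2,\dots,g_T^2)$ be a given (fixed) control strategy of agent 2, so that $U_t^2=g_t^2(M_t^2)$ for $t=0,\dots,T$. Consider agent 1's problem $\inf_{\boldsymbol{g}^1}\mathcal{J}^1(\boldsymbol{g}^1)$, where $$\mathcal{J}^1(\boldsymbol{g}^1)=\mathbb{E}^{\boldsymbol{g}}\Big[\sum_{t=0}^T c_t(X_t,U_t^1,U_t^2)\Big],\qquad \boldsymbol{g}=(\boldsymbol{g}^1,\boldsymbol{g}^2),$$ and the infimum is over all control strategies $\boldsymbol{g}^1=(g_0^1,\dots,g_T^1)$ of agent 1, with $g_t^1:\mathcal{M}_t^1\to\mathcal{U}_t^1$ and $U_t^1=g_t^1(M_t^1)$. Then the optimal control strategy $\boldsymbol{g}^{*1}$ of agent 1 in this problem has the structural form $$U_t^1=g_t^{*1}(M_t^2,\Pi_t^1),\qquad t=0,\dots,T,$$ where $\Pi_t^1=\mathbb{P}^{\boldsymbol{g}}(X_t\mid M_t^1)$ is the conditional distribution of the state given the memory of agent 1.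
   Context: Team model. Fix $T\in\mathbb{N}$; time runs over $t=0,\dots,T$. The state $X_t$ takes values in a finite set $\mathcal{X}_t$. Agents $k\in\{1,2\}$ choose actions $U_t^k$ in finite sets $\mathcal{U}_t^k$ and receive observations $Y_t^k$ in finite sets $\mathcal{Y}_t^k$. The dynamics are $X_{t+1}=f_t(X_t,U_t^1,U_t^2,W_t)$ for $t=0,\dots,T-1$, and $Y_t^k=h_t^k(X_t,V_t^k)$ for $t=0,\dots,T$, where the disturbances $W_t$ and measurement noises $V_t^k$ take values in finite sets. The primitive random variables $X_0$, $W_t$, $V_t^1$, $V_t^2$ ($t=0,\dots,T$) have probability distributions known a priori, and each is independent of all the others. The cost incurred at time $t$ is $c_t(X_t,U_t^1,U_t^2)\in\mathbb{R}_{\ge 0}$. The functions $c_t,f_t,h_t^1,h_t^2$ are given. Memories (nested information). $M_t^2=\{Y_{0:t}^2,U_{0:t-1}^2\}$ and $M_t^1=\{Y_{0:t}^1,U_{0:t-1}^1,Y_{0:t}^2,U_{0:t-1}^2\}$, with sets of possible values $\mathcal{M}_t^2$ and $\mathcal{M}_t^1$; here $A_{0:t}=(A_0,\dots,A_t)$. Thus $M_t^2\subseteq M_t^1$. A control strategy of agent $k$ is $\boldsymbol{g}^k=(g_0^k,\dots,g_T^k)$ with control laws $g_t^k:\mathcal{M}_t^k\to\mathcal{U}_t^k$ and $U_t^k=g_t^k(M_t^k)$; $\boldsymbol{g}=(\boldsymbol{g}^1,\boldsymbol{g}^2)$ is the strategy profile, and $\mathbb{P}^{\boldsymbol g},\mathbb{E}^{\boldsymbol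 g}$ denote probability and expectation under it. The information state $\Pi_t^1$ of agent 1 takes values in $\mathcal{P}_t^1=\Delta(\mathcal{X}_t)$, the set of probability distributions on $\mathcal{X}_t$. *)

(* Defs.v *)
From HB Require Import structures.
From mathcomp Require Export all_boot all_order all_algebra.
From mathcomp Require Export all_classical all_reals all_analysis.

Set Implicit Arguments.
Unset Strict Implicit.
Unset Printing Implicit Defensive.

Import Order.TTheory GRing.Theory Num.Theory.
Local Open Scope classical_set_scope.
Local Open Scope ring_scope.

(* All time-indexed data are families over [nat]; only the times
   [t <= horizon] matter, the components at later times being junk that no
   cost, independence condition or structural claim below refers to. *)
Record team (R : realType) := Team {
  horizon : nat;
  X : nat -> finType;
  U1 : nat -> finType;
  U2 : nat -> finType;
  Y1 : nat -> finType;
  Y2 : nat -> finType;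
  W : nat -> finType;
  V1 : nat -> finType;
  V2 : nat -> finType;
  dyn : forall t, X t -> U1 t -> U2 t -> W t -> X t.+1;
  obs1 : forall t, X t -> V1 t -> Y1 t;
  obs2 : forall t, X t -> V2 t -> Y2 t;
  cost : forall t, X t -> U1 t -> U2 t -> R;
  cost_ge0 : forall t x u1 u2, 0 <= @cost t x u1 u2
}.

(* The sets are finite and carry the discrete sigma-algebra, so measurability
   is a condition on fibers and independence ranges over arbitrary subsets. *)
Record primitives (R : realType) (S : team R) (d : measure_display)
    (Omega : measurableType d) (P : probability Omega R) := Primitives {
  x0 : Omega -> X S 0;
  w : forall t, Omega -> W S t;
  v1 : forall t, Omega -> V1 S t;
  v2 : forall t, Omega -> V2 S t;
  measurable_x0 : forall a, measurable (x0 @^-1` [set a]);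
  measurable_w : forall t a, measurable (@w t @^-1` [set a]);
  measurable_v1 : forall t a, measurable (@v1 t @^-1` [set a]);
  measurable_v2 : forall t a, measurable (@v2 t @^-1` [set a]);
  independence :
    forall (A : set (X S 0)) (B : forall t, set (W S t))
      (C1 : forall t, set (V1 S t)) (C2 : forall t, set (V2 S t)),
    (P (x0 @^-1` A `&` \bigcap_(t < (horizon S).+1)
          (@w t @^-1` B t `&` (@v1 t @^-1` C1 t `&` @v2 t @^-1` C2 t))) =
     P (x0 @^-1` A) * \prod_(t < (horizon S).+1)
       (P (@w t @^-1` B t) * (P (@v1 t @^-1` C1 t) * P (@v2 t @^-1` C2 t))))%E
}.

(* [hist Y U t] is the set of values of (Y_{0:t}, U_{0:t-1}). *)
Fixpoint hist (Y U : nat -> finType) (t : nat) : finType :=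
  if t is s.+1 then (hist Y U s * U s * Y s.+1)%type else Y 0.

Section Memories.
Context (R : realType) (S : team R).

Definition mem2 (t : nat) : finType := hist (Y2 S) (U2 S) t.

Definition mem1 (t : nat) : finType := (hist (Y1 S) (U1 S) t * mem2 t)%type.

Definition strategy1 := forall t, mem1 t -> U1 S t.
Definition strategy2 := forall t, mem2 t -> U2 S t.

End Memories.

Section Trajectories.
Context (R : realType) (S : team R) (d : measure_display)
  (Omega : measurableType d) (P : probability Omega R) (Z : primitives S P)
  (g1 : strategy1 S) (g2 : strategy2 S).

Fixpoint trajectory (omega : Omega) (t : nat) : X S t * mem1 S t :=
  match t with
  | 0 =>
    let x := x0 Z omega in
    (x, (obs1 x (v1 Z 0 omega), obs2 x (v2 Z 0 omega)))
  | s.+1 =>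
    let: (x, m) := trajectory omega s in
    let u1 := g1 m in
    let u2 := g2 m.2 in
    let x' := dyn x u1 u2 (w Z s omega) in
    (x', ((m.1, u1, obs1 x' (v1 Z s.+1 omega)),
          (m.2, u2, obs2 x' (v2 Z s.+1 omega))))
  end.

Definition Xt (t : nat) (omega : Omega) : X S t := (trajectory omega t).1.
Definition M1t (t : nat) (omega : Omega) : mem1 S t := (trajectory omega t).2.
Definition M2t (t : nat) (omega : Omega) : mem2 S t := (M1t t omega).2.
Definition U1t (t : nat) (omega : Omega) : U1 S t := g1 (M1t t omega).
Definition U2t (t : nat) (omega : Omega) : U2 S t := g2 (M2t t omega).

Definition J1 : \bar R :=
  'E_P[fun omega => \sum_(t < (horizon S).+1)
         cost (Xt t omega) (U1t t omega) (U2t t omega)].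

End Trajectories.

Definition optimal1 (R : realType) (S : team R) (d : measure_display)
    (Omega : measurableType d) (P : probability Omega R) (Z : primitives S P)
    (g2 : strategy2 S) (g1 : strategy1 S) : Prop :=
  J1 Z g1 g2 = ereal_inf (range (fun g => J1 Z g g2)).

Record Delta (R : realType) (A : finType) := MkDelta {
  pmf :> A -> R;
  pmf_ge0 : forall a, 0 <= pmf a;
  pmf_sum1 : \sum_a pmf a = 1
}.

(* [pi] is the realization at [omega] of P(X_t | M_t^1).  When the memory
   M_t^1(omega) has probability 0, the quotients all vanish and no [pi] in the
   simplex satisfies this; such [omega] form a null set. *)
Definition is_Pi1 (R : realType) (S : team R) (d : measure_display)
    (Omega : measurableType d) (P : probability Omega R) (Z : primitives S P)
    (g1 : strategy1 S) (g2 : strategy2 S) (t : nat) (omega : Omega)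
    (pi : Delta R (X S t)) : Prop :=
  let M := M1t Z g1 g2 t @^-1` [set M1t Z g1 g2 t omega] in
  forall x, pi x = fine (P (Xt Z g1 g2 t @^-1` [set x] `&` M)) / fine (P M).

Definition structural_form1 (R : realType) (S : team R) (d : measure_display)
    (Omega : measurableType d) (P : probability Omega R) (Z : primitives S P)
    (g1 : strategy1 S) (g2 : strategy2 S)
    (gamma : forall t, mem2 S t -> Delta R (X S t) -> U1 S t) : Prop :=
  forall t, (t <= horizon S)%N ->
    {ae P, forall omega, exists pi : Delta R (X S t),
      is_Pi1 Z g1 g2 omega pi /\
      U1t Z g1 g2 t omega = gamma t (M2t Z g1 g2 t omega) pi}.

(* Main.v *)
From mathcomp Require Import ring zify measurable_realfun.
Require Import Defs.

Set Implicit Arguments.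
Unset Strict Implicit.
Unset Printing Implicit Defensive.

(** Once agent 2's strategy is fixed, agent 1 faces a partially observed
control problem in which it sees everything that drives agent 2's actions, and
dynamic programming on the pair (M_t^2, Pi_t^1) solves it. The proof works with
unnormalised beliefs, so that no conditioning on null events occurs.

The forward half: [unnormalized_filter m x] is computed from the observations
and actions recorded in the memory [m] alone, without reference to a strategy.
Because the noises are independent, [joint_law] holds: P(X_t = x, M_t^1 = m) is
this filter if the actions recorded in [m] are those that the two strategies
prescribe, and 0 otherwise. Hence the strategy of agent 1 only selects which
memories occur, and at a memory of positive probability Pi_t^1 is the
normalised filter ([posterior_normalize]).

The backward half: [value] solves the Bellman equation for the state (M_t^2,
unnormalised belief). The belief is updated by [filter_step], which depends on
M_t^2 only through agent 2's action. Let the cost-to-go be the sum over the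
memories [m] of the value at the measure P(X_t = ., M_t^1 = m). [bellman_step]
and minimality show that it is at most the expected cost incurred from t on,
with equality if every action is a minimiser. At t = 0 it does not depend on
the strategy, which makes minimising actions optimal.

The halves meet because the value function is positively homogeneous in the
belief: an action that is optimal at Pi_t^1 is optimal at every multiple of it,
so the minimiser may be chosen as a function of (M_t^2, Pi_t^1). *)

Import Order.TTheory GRing.Theory Num.Theory.

(** * Random variables with values in a finite set *)

Section FiniteRandomVariables.
Local Open Scope classical_set_scope.
Local Open Scope ring_scope.
Context (R : realType) (d : measure_display) (Omega : measurableType d)
  (P : probability Omega R).

Definition finite_rv (F : finType) (A : Omega -> F) :=
  forall B : set F, measurable (A @^-1` B).

Lemma finite_rv_fibers (F : finType) (A : Omega -> F) :
  (forall a, measurable (A @^-1` [set a])) -> finite_rv A.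
Proof.
move=> mA B.
have -> : A @^-1` B = \bigcup_(a in B) A @^-1` [set a].
  by apply/seteqP; split=> [z Bz|z [a Ba /= ->]] //; exists (A z).
by apply: fin_bigcup_measurable => //; exact: finite_finset.
Qed.

Lemma finite_rv_pair (F G : finType) (A : Omega -> F) (B : Omega -> G) :
  finite_rv A -> finite_rv B -> finite_rv (fun z => (A z, B z)).
Proof.
move=> mA mB; apply: finite_rv_fibers => -[a b].
have -> : (fun z => (A z, B z)) @^-1` [set (a, b)] =
    A @^-1` [set a] `&` B @^-1` [set b].
  by apply/seteqP; split=> [z [<- <-]|z [/= -> ->]].
exact: measurableI.
Qed.

Lemma finite_rv_comp (F G : finType) (f : F -> G) (A : Omega -> F) :
  finite_rv A -> finite_rv (f \o A).
Proof. by move=> mA B; exact: (mA (f @^-1` B)). Qed.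

Definition pr (E : set Omega) : R := fine (P E).

Lemma prE (E : set Omega) : measurable E -> P E = (pr E)%:E.
Proof. by move=> mE; rewrite fineK// fin_num_measure. Qed.

Lemma pr_ge0 (E : set Omega) : 0 <= pr E.
Proof. exact: fine_ge0. Qed.

Lemma pr0 : pr set0 = 0.
Proof. by rewrite /pr measure0. Qed.

Lemma prT : pr setT = 1.
Proof. by rewrite /pr probability_setT. Qed.

(** Restricting the integral to an event makes this serve twice: for the
expected cost on the whole space, and with [f] constant for the law of total
probability. *)
Lemma integral_finite_rv (F : finType) (A : Omega -> F) (f : F -> R)
    (E : set Omega) :
  finite_rv A -> measurable E -> (forall a, 0 <= f a) ->
  (\int[P]_(z in E) (f (A z))%:E)%E =
  (\sum_a f a * pr (A @^-1` [set a] `&` E))%:E.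
Proof.
move=> mA mE f0.
have m1 a : measurable_fun E (fun z => (\1_(A @^-1` [set a]) z : R)%:E).
  exact/measurable_EFinP/measurable_indic.
under eq_integral => z _.
  have -> : (f (A z))%:E =
      (\sum_a (f a)%:E * (\1_(A @^-1` [set a]) z)%:E)%E.
    rewrite (bigD1 (A z))//= big1 ?adde0.
      by rewrite indicE mem_set// mule1.
    move=> a /eqP aA; rewrite indicE memNset ?mule0//= => /esym.
    exact: aA.
  over.
rewrite ge0_integral_sum//; last 2 first.
- by move=> a; exact: measurable_funeM.
- by move=> a z _; rewrite -EFinM lee_fin mulr_ge0// indicE ler0n.
rewrite -sumEFin; apply: eq_bigr => a _.
rewrite ge0_integralZl_EFin//.
by rewrite integral_indic// EFinM; congr (_ * _)%E; exact/prE/measurableI.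
Qed.

Lemma total_probability (F : finType) (A : Omega -> F) (E : set Omega) :
  finite_rv A -> measurable E ->
  pr E = \sum_a pr (A @^-1` [set a] `&` E).
Proof.
move=> mA mE; apply: EFin_inj.
under [in RHS]eq_bigr do rewrite -[pr _]mul1r.
rewrite -(integral_finite_rv (f := fun=> 1))//.
rewrite integral_cst// mul1e; exact/esym/prE.
Qed.

End FiniteRandomVariables.

(** * The law of the state and agent 1's memory *)

Section JointLaw.
Local Open Scope classical_set_scope.
Local Open Scope ring_scope.
Context (R : realType) (S : team R) (d : measure_display)
  (Omega : measurableType d) (P : probability Omega R) (Z : primitives S P).

Lemma finite_rv_x0 : finite_rv (x0 Z).
Proof. exact/finite_rv_fibers/measurable_x0. Qed.

Lemma finite_rv_w t : finite_rv (w Z t).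
Proof. exact/finite_rv_fibers/measurable_w. Qed.

Lemma finite_rv_v1 t : finite_rv (v1 Z t).
Proof. exact/finite_rv_fibers/measurable_v1. Qed.

Lemma finite_rv_v2 t : finite_rv (v2 Z t).
Proof. exact/finite_rv_fibers/measurable_v2. Qed.

Definition likelihood t (x : X S t) (y1 : Y1 S t) (y2 : Y2 S t) : R :=
  pr P (v1 Z t @^-1` [set v | obs1 x v = y1]) *
  pr P (v2 Z t @^-1` [set v | obs2 x v = y2]).

Definition transition t (x : X S t) (u1 : U1 S t) (u2 : U2 S t)
    (x' : X S t.+1) : R :=
  pr P (w Z t @^-1` [set e | dyn x u1 u2 e = x']).

Definition filter_step t (u1 : U1 S t) (u2 : U2 S t) (y1 : Y1 S t.+1)
    (y2 : Y2 S t.+1) (a : X S t -> R) : X S t.+1 -> R :=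
  fun x' => (\sum_x a x * transition x u1 u2 x') * likelihood x' y1 y2.

Definition past t (m : mem1 S t.+1) : mem1 S t := (m.1.1.1, m.2.1.1).

(** The actions are read off the memory instead of being produced by control
laws: this is what makes the filter independent of the strategies. *)
Fixpoint unnormalized_filter t : mem1 S t -> X S t -> R :=
  match t with
  | 0 => fun m x => pr P (x0 Z @^-1` [set x]) * likelihood x m.1 m.2
  | s.+1 => fun m =>
    filter_step m.1.1.2 m.2.1.2 m.1.2 m.2.2 (unnormalized_filter (past m))
  end.

Fixpoint compatible (g1 : strategy1 S) (g2 : strategy2 S) t :
    mem1 S t -> bool :=
  match t with
  | 0 => fun=> true
  | s.+1 => fun m => [&& compatible g1 g2 (past m),
      m.1.1.2 == g1 s (past m) & m.2.1.2 == g2 s (past m).2]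
  end.

Section Strategies.
Context (g1 : strategy1 S) (g2 : strategy2 S).

Lemma finite_rv_trajectory t : finite_rv ((trajectory Z g1 g2)^~ t).
Proof.
elim: t => [|t IH].
  pose start (p : X S 0 * (V1 S 0 * V2 S 0)) : X S 0 * mem1 S 0 :=
    (p.1, (obs1 p.1 p.2.1, obs2 p.1 p.2.2)).
  move=> B; exact: (finite_rv_pair finite_rv_x0
    (finite_rv_pair (@finite_rv_v1 0) (@finite_rv_v2 0)) (start @^-1` B)).
pose next (p : (X S t * mem1 S t) * (W S t * (V1 S t.+1 * V2 S t.+1))) :
    X S t.+1 * mem1 S t.+1 :=
  let: (x, m) := p.1 in
  let x' := dyn x (g1 m) (g2 m.2) p.2.1 in
  (x', ((m.1, g1 m, obs1 x' p.2.2.1), (m.2, g2 m.2, obs2 x' p.2.2.2))).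
move=> B; exact: (finite_rv_pair IH (finite_rv_pair (@finite_rv_w t)
  (finite_rv_pair (@finite_rv_v1 t.+1) (@finite_rv_v2 t.+1))) (next @^-1` B)).
Qed.

End Strategies.

(** Noise events are cylinders given by one constraint per time, so imposing one
further constraint on a coordinate that was free is an update by
[eqtype.dfwith], and it multiplies the probability by one factor. *)
Section Cylinders.
Context (F : nat -> finType) (z : forall t, Omega -> F t) (n : nat).

Definition cylinder (B : forall t, set (F t)) : set Omega :=
  [set o | forall t, (t < n)%N -> B t (z t o)].

Context (t : nat) (ltn : (t < n)%N) (B : forall t, set (F t))
  (BT : @B t = setT) (K : set (F t)).

Lemma cylinder_dfwith :
  cylinder (eqtype.dfwith (@B) K) = cylinder (@B) `&` z t @^-1` K.
Proof.
apply/seteqP; split=> [u uB|u [uB uK] s sn].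
  split; last by have := uB t ltn; rewrite dfwith_in.
  move=> s sn; have [->|ts] := eqVneq s t; first by rewrite BT.
  by have := uB s sn; rewrite dfwith_out// eq_sym.
have [ts|ts] := eqVneq t s; last by rewrite dfwith_out//; exact: uB.
by case: _ / ts; rewrite dfwith_in.
Qed.

Lemma prod_dfwith :
  \prod_(s < n) pr P (z (val s) @^-1` eqtype.dfwith (@B) K (val s)) =
  pr P (z t @^-1` K) * \prod_(s < n) pr P (z (val s) @^-1` @B (val s)).
Proof.
rewrite (bigD1 (Ordinal ltn))//= [in RHS](bigD1 (Ordinal ltn))//=.
rewrite dfwith_in BT preimage_setT prT mul1r; congr (_ * _).
apply: eq_bigr => s st; rewrite dfwith_out//.
by rewrite -val_eqE eq_sym in st.
Qed.

End Cylinders.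

Let T := (horizon S).+1.

Definition noise_event (B : forall t, set (W S t))
    (C1 : forall t, set (V1 S t)) (C2 : forall t, set (V2 S t)) : set Omega :=
  cylinder (w Z) T B `&` (cylinder (v1 Z) T C1 `&` cylinder (v2 Z) T C2).

Definition noise_weight (B : forall t, set (W S t))
    (C1 : forall t, set (V1 S t)) (C2 : forall t, set (V2 S t)) : R :=
  \prod_(t < T) pr P (w Z t @^-1` B (val t)) *
  (\prod_(t < T) pr P (v1 Z t @^-1` C1 (val t)) *
   \prod_(t < T) pr P (v2 Z t @^-1` C2 (val t))).

Lemma noise_eventE (B : forall t, set (W S t))
    (C1 : forall t, set (V1 S t)) (C2 : forall t, set (V2 S t)) :
  noise_event B C1 C2 =
  \bigcap_(t < T) (w Z t @^-1` B t `&`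
    (v1 Z t @^-1` C1 t `&` v2 Z t @^-1` C2 t)).
Proof.
apply/seteqP; split=> [u [uB [u1 u2]] t tT|u h].
  by split; [exact: uB|split; [exact: u1|exact: u2]].
by split; [|split] => t tT; have [? [? ?]] := h t tT.
Qed.

Lemma measurable_noise_event (B : forall t, set (W S t))
    (C1 : forall t, set (V1 S t)) (C2 : forall t, set (V2 S t)) :
  measurable (noise_event B C1 C2).
Proof.
rewrite noise_eventE; apply: bigcap_measurable; first by exists 0.
move=> t _; apply: measurableI; first exact: finite_rv_w.
apply: measurableI; [exact: finite_rv_v1|exact: finite_rv_v2].
Qed.

Lemma pr_independence (A : set (X S 0)) (B : forall t, set (W S t))
    (C1 : forall t, set (V1 S t)) (C2 : forall t, set (V2 S t)) :
  pr P (x0 Z @^-1` A `&` noise_event B C1 C2) =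
  pr P (x0 Z @^-1` A) * noise_weight B C1 C2.
Proof.
apply: EFin_inj; rewrite -prE; last first.
  apply: measurableI; [exact: finite_rv_x0|exact: measurable_noise_event].
rewrite noise_eventE independence EFinM prE; last exact: finite_rv_x0.
congr (_ * _)%E; rewrite /noise_weight -!big_split -prodEFin.
apply: eq_bigr => t _; rewrite !EFinM !prE//.
- exact: finite_rv_v2.
- exact: finite_rv_v1.
- exact: finite_rv_w.
Qed.

Lemma compatibleS g1 g2 t (m : mem1 S t.+1) :
  compatible g1 g2 m = compatible g1 g2 (past m) &&
    ((m.1.1.2 == g1 t (past m)) && (m.2.1.2 == g2 t (past m).2)).
Proof. by []. Qed.

(** The memory at time t+1 determines all of the memory at time t; only the
state at time t is lost, so a one-step transition is a sum over that state
alone. *)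
Lemma trajectory_stepP g1 g2 u t (x : X S t) (x' : X S t.+1)
    (m : mem1 S t.+1) :
  (trajectory Z g1 g2 u t).1 = x /\ trajectory Z g1 g2 u t.+1 = (x', m) <->
  (m.1.1.2 == g1 t (past m)) && (m.2.1.2 == g2 t (past m).2) /\
  [/\ trajectory Z g1 g2 u t = (x, past m),
      dyn x m.1.1.2 m.2.1.2 (w Z t u) = x',
      obs1 x' (v1 Z t.+1 u) = m.1.2 & obs2 x' (v2 Z t.+1 u) = m.2.2].
Proof.
case: m => [[[h1 u1] y1] [[h2 u2] y2]]; rewrite /past /=.
case: (trajectory Z g1 g2 u t) => x1 [k1 k2] /=; split.
  by case=> -> [<- <- <- <- <- <- <-]; rewrite !eqxx.
by case=> /andP[/eqP -> /eqP ->] [[-> -> ->] <- <- <-].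
Qed.

(** The later noises are carried along in the induction: constraints on the
noises acting after time t are what expresses that these noises are independent
of (X_t, M_t^1), and they absorb the transition to time t+1, whose noises are
then among the constrained ones. *)
Lemma joint_law_noise g1 g2 t (m : mem1 S t) (x : X S t)
    (B : forall t, set (W S t))
    (C1 : forall t, set (V1 S t)) (C2 : forall t, set (V2 S t)) :
  (t <= horizon S)%N ->
  (forall s, (s < t)%N -> B s = setT) ->
  (forall s, (s <= t)%N -> C1 s = setT) ->
  (forall s, (s <= t)%N -> C2 s = setT) ->
  pr P ((trajectory Z g1 g2)^~ t @^-1` [set (x, m)] `&` noise_event B C1 C2) =
  (compatible g1 g2 m)%:R * unnormalized_filter m x * noise_weight B C1 C2.
Proof.
elim: t m x B C1 C2 => [|t IH] m x B C1 C2 tT BT C1T C2T.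
  case: m => y1 y2; rewrite mul1r /=.
  pose K1 := [set v | obs1 x v = y1]; pose K2 := [set v | obs2 x v = y2].
  have -> : (trajectory Z g1 g2)^~ 0 @^-1` [set (x, (y1, y2))] `&`
      noise_event B C1 C2 = x0 Z @^-1` [set x] `&`
      noise_event B (eqtype.dfwith C1 K1) (eqtype.dfwith C2 K2).
    rewrite /noise_event !cylinder_dfwith ?C1T ?C2T//.
    apply/seteqP; split=> [u|u]; rewrite /K1 /K2 /=.
      by case=> -[-> <- <-] [uB [u1 u2]].
    by case=> -> [uB [[u1 ->] [u2 ->]]].
  rewrite pr_independence /noise_weight !prod_dfwith ?C1T ?C2T//.
  by rewrite /likelihood -/K1 -/K2 -!mulrA; congr (_ * _); ring.
pose u1 := m.1.1.2; pose u2 := m.2.1.2.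
pose Kw x1 := [set e | dyn x1 u1 u2 e = x].
pose K1 := [set v | obs1 x v = m.1.2]; pose K2 := [set v | obs2 x v = m.2.2].
set E := (X in pr P X).
have mE : measurable E.
  apply: measurableI; last exact: measurable_noise_event.
  exact: finite_rv_trajectory.
have mX : finite_rv (fun z => (trajectory Z g1 g2 z t).1).
  exact: finite_rv_comp (@finite_rv_trajectory g1 g2 t).
rewrite (total_probability P mX mE) {mE mX}.
have [/andP[ok1 ok2]|/negP ko] :=
  boolP ((u1 == g1 t (past m)) && (u2 == g2 t (past m).2)); last first.
  have -> : compatible g1 g2 m = false.
    by apply/negP; rewrite compatibleS => /andP[_ /ko].
  rewrite !mul0r big1// => x1 _.
  rewrite -[RHS](pr0 P); congr pr; apply/seteqP; split=> // z /= [zx [zm _]].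
  by have /trajectory_stepP[] := conj zx zm.
(* Given X_t = x1 and the past memory, reaching (x, m) says just that w_t,
v1_{t+1} and v2_{t+1} lie in Kw x1, K1 and K2: the induction hypothesis applies
with these as additional constraints. *)
transitivity (\sum_x1 (compatible g1 g2 (past m))%:R *
    unnormalized_filter (past m) x1 * (transition x1 u1 u2 x *
    likelihood x m.1.2 m.2.2 * noise_weight B C1 C2)).
  apply: eq_bigr => x1 _.
  have -> : (fun z => (trajectory Z g1 g2 z t).1) @^-1` [set x1] `&` E =
      (trajectory Z g1 g2)^~ t @^-1` [set (x1, past m)] `&`
      noise_event (eqtype.dfwith B (Kw x1)) (eqtype.dfwith C1 K1)
        (eqtype.dfwith C2 K2).
    rewrite /noise_event !cylinder_dfwith ?BT ?C1T ?C2T// 1?ltnW//.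
    apply/seteqP; split=> z.
      case=> zx [zm [zB [z1 z2]]].
      by have /trajectory_stepP[_ [? ? ? ?]] := conj zx zm.
    case=> zt [[zB zw] [[z1 zv1] [z2 zv2]]].
    have /trajectory_stepP[zx zm] := conj (introT andP (conj ok1 ok2))
      (And4 zt zw zv1 zv2).
    by split.
  rewrite IH; last 4 first.
  - exact: ltnW.
  - by move=> s st; rewrite dfwith_out ?BT ?gtn_eqF// ltnW.
  - by move=> s st; rewrite dfwith_out ?C1T ?gtn_eqF// ltnW.
  - by move=> s st; rewrite dfwith_out ?C2T ?gtn_eqF// ltnW.
  rewrite /noise_weight !prod_dfwith ?BT ?C1T ?C2T// 1?ltnW//.
  rewrite /transition /likelihood -/K1 -/K2 -/(Kw x1) -!mulrA.
  by congr (_ * (_ * _)); ring.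
have -> : compatible g1 g2 m = compatible g1 g2 (past m).
  by rewrite compatibleS; apply: andb_idr => _; apply/andP.
rewrite /= /filter_step -/u1 -/u2.
rewrite mulr_suml mulr_sumr mulr_suml.
by apply: eq_bigr => x1 _; ring.
Qed.

Lemma joint_law g1 g2 t (m : mem1 S t) (x : X S t) :
  (t <= horizon S)%N ->
  pr P ((trajectory Z g1 g2)^~ t @^-1` [set (x, m)]) =
  (compatible g1 g2 m)%:R * unnormalized_filter m x.
Proof.
move=> tT; have := @joint_law_noise g1 g2 t m x (fun=> setT) (fun=> setT)
  (fun=> setT) tT (fun _ _ => erefl) (fun _ _ => erefl) (fun _ _ => erefl).
have -> : noise_event (fun=> setT) (fun=> setT) (fun=> setT) = setT.
  by apply/seteqP; split=> // u _; do !split.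
rewrite setIT => ->; rewrite /noise_weight.
by rewrite !big1 ?mulr1// => s _; rewrite preimage_setT prT.
Qed.

End JointLaw.

(** * Dynamic programming over unnormalised beliefs *)

Section DynamicProgramming.
Local Open Scope classical_set_scope.
Local Open Scope ring_scope.
Context (R : realType) (S : team R) (U1_inhabited : forall t, (0 < #|U1 S t|)%N)
  (d : measure_display) (Omega : measurableType d) (P : probability Omega R)
  (Z : primitives S P) (g2 : strategy2 S).

(** This is P(X_t = ., M_t^1 = m) for t up to the horizon, by [joint_law]. *)
Definition joint (g1 : strategy1 S) t (m : mem1 S t) : X S t -> R :=
  fun x => (compatible g1 g2 m)%:R * unnormalized_filter Z m x.

Definition stage_cost (g1 : strategy1 S) t : R :=
  \sum_(m : mem1 S t) \sum_x joint g1 m x * cost x (g1 t m) (g2 m.2).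

Lemma J1_sum_stage_cost g1 :
  J1 Z g1 g2 = (\sum_(t < (horizon S).+1) stage_cost g1 t)%:E.
Proof.
rewrite /J1 unlock.
pose f t (p : X S t * mem1 S t) : R := cost p.1 (g1 t p.2) (g2 p.2.2).
have f0 t (p : X S t * mem1 S t) : 0 <= f t p by exact: cost_ge0.
have mtraj t := @finite_rv_trajectory _ _ _ _ _ Z g1 g2 t.
transitivity (\int[P]_z
    (\sum_(t < (horizon S).+1) (f t (trajectory Z g1 g2 z t))%:E))%E.
  by apply: eq_integral => z _; rewrite sumEFin.
rewrite ge0_integral_sum//; last 2 first.
- move=> t; apply/measurable_EFinP => _ B _; rewrite setTI.
  exact: (mtraj t (f t @^-1` B)).
- by move=> t z _; rewrite lee_fin.
rewrite -sumEFin; apply: eq_bigr => t _.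
rewrite (integral_finite_rv _ (mtraj t))//; congr EFin.
rewrite /stage_cost exchange_big/= pair_bigA; apply: eq_bigr => -[x m] _ /=.
rewrite setIT mulrC; congr (_ * _).
exact: (joint_law Z g1 g2 m x (ltn_ord t)).
Qed.

Section Bellman.
Context (t : nat) (V : mem2 S t.+1 -> (X S t.+1 -> R) -> R).

(** As the updated belief is left unnormalised, the probability of the next
observations is carried by its mass and does not appear as a weight. *)
Definition action_value (m2 : mem2 S t) (a : X S t -> R) (u : U1 S t) : R :=
  \sum_x a x * cost x u (g2 m2) +
  \sum_y1 \sum_y2 V (m2, g2 m2, y2) (filter_step Z u (g2 m2) y1 y2 a).

Definition best_action (m2 : mem2 S t) (a : X S t -> R) : U1 S t :=
  [arg min_(u < enum_val (Ordinal (U1_inhabited t))) action_value m2 a u]%O.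

Lemma best_action_le m2 a u :
  action_value m2 a (best_action m2 a) <= action_value m2 a u.
Proof. by rewrite /best_action; case: arg_minP => // i _; exact. Qed.

End Bellman.

(** The counter [n] is the number of stages left; the recursion is on it because
time increases along it. *)
Fixpoint value n t (m2 : mem2 S t) (a : X S t -> R) : R :=
  if n is k.+1 then
    action_value (@value k t.+1) m2 a (best_action (@value k t.+1) m2 a)
  else 0.

Definition pos_homogeneous t (V : mem2 S t -> (X S t -> R) -> R) :=
  forall m2 a c, 0 <= c -> V m2 (fun x => c * a x) = c * V m2 a.

Lemma action_value_homogeneous t (V : mem2 S t.+1 -> (X S t.+1 -> R) -> R) u :
  pos_homogeneous V -> pos_homogeneous (fun m2 a => action_value V m2 a u).
Proof.
move=> hV m2 a c c0; rewrite /action_value mulrDr !mulr_sumr; congr (_ + _).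
  by apply: eq_bigr => x _; rewrite mulrA.
apply: eq_bigr => y1 _; rewrite mulr_sumr; apply: eq_bigr => y2 _.
rewrite -hV//; congr V; apply/funext => x'; rewrite /filter_step.
rewrite [RHS]mulrA mulr_sumr; congr (_ * _).
by apply: eq_bigr => x _; rewrite mulrA.
Qed.

(** A minimum of positively homogeneous functions is positively homogeneous:
each inequality tests the minimality of one best action against the other. *)
Lemma value_homogeneous n t : pos_homogeneous (@value n t).
Proof.
elim: n t => [|n IH] t m2 a c c0; first by rewrite mulr0.
have hQ u := action_value_homogeneous u (IH t.+1).
apply/le_anti/andP; split => /=; rewrite -(hQ _ m2 a c c0).
  exact: best_action_le.
by rewrite !hQ// ler_wpM2l// best_action_le.
Qed.

Lemma pos_homogeneous0 t (V : mem2 S t -> (X S t -> R) -> R) m2 :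
  pos_homogeneous V -> V m2 (fun=> 0) = 0.
Proof.
move=> hV; rewrite -[RHS](mul0r (V m2 (fun=> 0))) -hV//.
by congr V; apply/funext => x; rewrite mul0r.
Qed.

Definition extend t
    (p : mem1 S t * (U1 S t * U2 S t) * (Y1 S t.+1 * Y2 S t.+1)) :
    mem1 S t.+1 :=
  ((p.1.1.1, p.1.2.1, p.2.1), (p.1.1.2, p.1.2.2, p.2.2)).

Lemma extend_bij t : bijective (@extend t).
Proof.
exists (fun m => (past m, (m.1.1.2, m.2.1.2), (m.1.2, m.2.2))).
  by case=> [[[? ?] [? ?]] [? ?]].
by case=> [[[? ?] ?] [[? ?] ?]].
Qed.

Lemma joint_extend g1 t (m : mem1 S t) u1 u2 y1 y2 :
  joint g1 (extend (m, (u1, u2), (y1, y2))) =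
  if (u1 == g1 t m) && (u2 == g2 m.2)
  then filter_step Z u1 u2 y1 y2 (joint g1 m) else fun=> 0.
Proof.
case: m => k1 k2; apply/funext => x; rewrite /joint compatibleS /past /=.
case: (_ && (u2 == _)); rewrite ?andbF ?mul0r// andbT /filter_step.
rewrite [LHS]mulrA mulr_sumr; congr (_ * _).
by apply: eq_bigr => x1 _; rewrite mulrA.
Qed.

(** A next memory is a memory extended by actions and observations; extensions
by actions other than the prescribed ones carry the zero measure, where [V]
vanishes by homogeneity. *)
Lemma bellman_step g1 t (V : mem2 S t.+1 -> (X S t.+1 -> R) -> R) :
  pos_homogeneous V ->
  \sum_(m : mem1 S t) action_value V m.2 (joint g1 m) (g1 t m) =
  stage_cost g1 t + \sum_(m : mem1 S t.+1) V m.2 (joint g1 m).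
Proof.
move=> hV; rewrite big_split /=; congr (_ + _).
rewrite [RHS](reindex (@extend t))/=; last exact/onW_bij/extend_bij.
rewrite -(pair_bigA _ (fun a y => V (extend (a, y)).2
  (joint g1 (extend (a, y))))).
rewrite -(pair_bigA _ (fun m u => \sum_y V (extend (m, u, y)).2
  (joint g1 (extend (m, u, y))))) /=.
apply: eq_bigr => m _; rewrite (bigD1 (g1 t m, g2 m.2))//=.
rewrite [X in _ + X]big1 ?addr0.
  rewrite pair_bigA; apply: eq_bigr => -[y1 y2] _.
  by rewrite joint_extend !eqxx.
move=> [u1 u2] /negbTE; rewrite xpair_eqE => ko; apply: big1 => -[y1 y2] _.
by rewrite joint_extend ko pos_homogeneous0.
Qed.

Definition cost_to_go g1 n t : R :=
  \sum_(m : mem1 S t) value n m.2 (joint g1 m).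

Lemma cost_to_go_le g1 n t :
  cost_to_go g1 n t <= \sum_(i < n) stage_cost g1 (t + i).
Proof.
elim: n t => [|n IH] t; first by rewrite /cost_to_go big_ord0 big1.
rewrite big_ord_recl addn0.
apply: (@le_trans _ _ (stage_cost g1 t + cost_to_go g1 n t.+1)).
  rewrite -(bellman_step g1 (@value_homogeneous n t.+1)).
  by apply: ler_sum => m _; exact: best_action_le.
rewrite lerD2l (le_trans (IH _))// le_eqVlt; apply/orP; left; apply/eqP.
by apply: eq_bigr => i _; rewrite lift0 addSnnS.
Qed.

Definition normalize t (a : X S t -> R) : X S t -> R :=
  fun x => a x / \sum_x' a x'.

(** At time t the remaining stages are t, ..., T; the first of them is the one
being decided, which leaves T - t for the continuation value. *)
Definition belief_action t (m2 : mem2 S t) (pi : X S t -> R) : U1 S t :=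
  best_action (@value (horizon S - t) t.+1) m2 pi.

Definition belief_strategy : strategy1 S := fun t m =>
  belief_action m.2 (normalize (unnormalized_filter Z m)).

Lemma unnormalized_filter_ge0 t (m : mem1 S t) x :
  0 <= unnormalized_filter Z m x.
Proof.
have l0 s (x' : X S s) y1 y2 : 0 <= likelihood Z x' y1 y2.
  by rewrite mulr_ge0// pr_ge0.
elim: t m x => [|t IH] m x; first by rewrite mulr_ge0// pr_ge0.
by rewrite mulr_ge0// sumr_ge0// => x1 _; rewrite mulr_ge0// pr_ge0.
Qed.

(** Holds also when the filter has mass 0 or [m] is incompatible with the
strategies: then the measure is null and [c] is 0. *)
Lemma joint_belief g1 t (m : mem1 S t) : exists2 c, 0 <= c &
  joint g1 m = fun x => c * normalize (unnormalized_filter Z m) x.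
Proof.
have f0 := unnormalized_filter_ge0 m.
exists ((compatible g1 g2 m)%:R * \sum_x unnormalized_filter Z m x).
  by rewrite mulr_ge0 ?ler0n// sumr_ge0.
apply/funext => x; rewrite /joint -mulrA; congr (_ * _).
rewrite /normalize mulrCA.
have [s0|s0] := eqVneq (\sum_x' unnormalized_filter Z m x') 0.
  by rewrite s0 mul0r mulr0; exact: (psumr_eq0P (fun i _ => f0 i) s0).
by rewrite divff// mulr1.
Qed.

(** Homogeneity transports the minimality of the chosen action from the
normalised belief to the actual measure. *)
Lemma cost_to_go_belief_strategy n t : (n + t = (horizon S).+1)%N ->
  cost_to_go belief_strategy n t =
  \sum_(i < n) stage_cost belief_strategy (t + i).
Proof.
elim: n t => [|n IH] t nt; first by rewrite /cost_to_go big_ord0 big1.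
rewrite big_ord_recl addn0.
transitivity (stage_cost belief_strategy t + cost_to_go belief_strategy n t.+1).
  rewrite -(bellman_step belief_strategy (@value_homogeneous n t.+1)).
  apply: eq_bigr => m _; have [c c0 ->] := joint_belief belief_strategy m.
  rewrite value_homogeneous// action_value_homogeneous//; last first.
    exact: value_homogeneous.
  rewrite /belief_strategy /belief_action.
  by have -> : (horizon S - t)%N = n by lia.
rewrite IH; last by rewrite addnS -addSn.
by congr (_ + _); apply: eq_bigr => i _; rewrite lift0 addSnnS.
Qed.

(** Both sides of the comparison start from the same cost-to-go at time 0,
where no action has been recorded and the joint measure is common to all
strategies. *)
Lemma belief_strategy_optimal : optimal1 Z g2 belief_strategy.
Proof.
have le g : (J1 Z belief_strategy g2 <= J1 Z g g2)%E.
  rewrite !J1_sum_stage_cost lee_fin.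
  have := cost_to_go_belief_strategy (addn0 (horizon S).+1).
  by under eq_bigr do rewrite add0n; move=> <-; exact: cost_to_go_le g _ 0.
apply/le_anti/andP; split.
  by apply: le_ereal_inf_tmp => _ [g _ <-]; exact: le.
by apply: ereal_inf_lbound; exists belief_strategy.
Qed.

Lemma state_memory_prob g1 t (m : mem1 S t) x : (t <= horizon S)%N ->
  pr P (Xt Z g1 g2 t @^-1` [set x] `&` M1t Z g1 g2 t @^-1` [set m]) =
  joint g1 m x.
Proof.
move=> tT; rewrite -[RHS](joint_law Z g1 g2 m x tT); congr pr.
apply/seteqP; split=> z; rewrite /Xt /M1t /=; last by move=> ->.
by case=> <- <-; case: trajectory.
Qed.

Lemma measurable_memory g1 t (m : mem1 S t) :
  measurable (M1t Z g1 g2 t @^-1` [set m]).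
Proof.
exact: (@finite_rv_trajectory _ _ _ _ _ Z g1 g2 t (snd @^-1` [set m])).
Qed.

Lemma memory_prob g1 t (m : mem1 S t) : (t <= horizon S)%N ->
  pr P (M1t Z g1 g2 t @^-1` [set m]) = \sum_x joint g1 m x.
Proof.
move=> tT; have mX : finite_rv (Xt Z g1 g2 t).
  exact: (finite_rv_comp fst (@finite_rv_trajectory _ _ _ _ _ Z g1 g2 t)).
rewrite (total_probability P mX (measurable_memory g1 m)).
by apply: eq_bigr => x _; exact: state_memory_prob.
Qed.

(** There are finitely many memories, so the null ones form a null event. *)
Lemma ae_memory_prob_neq0 g1 t :
  {ae P, forall z, pr P (M1t Z g1 g2 t @^-1` [set M1t Z g1 g2 t z]) != 0}.
Proof.
have : {ae P, forall z (m : mem1 S t), M1t Z g1 g2 t z = m ->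
    pr P (M1t Z g1 g2 t @^-1` [set m]) != 0}.
  apply: filter_forall => m.
  have mm := measurable_memory g1 m.
  have [p0|p0] := eqVneq (pr P (M1t Z g1 g2 t @^-1` [set m])) 0; last first.
    by apply: nearW.
  exists (M1t Z g1 g2 t @^-1` [set m]); split=> //; first by rewrite prE ?p0.
  by move=> z /=; apply: contra_notP => zm /zm.
by apply: filterS => z; exact.
Qed.

Lemma posterior_normalize g1 t (m : mem1 S t) x : (t <= horizon S)%N ->
  pr P (M1t Z g1 g2 t @^-1` [set m]) != 0 ->
  pr P (Xt Z g1 g2 t @^-1` [set x] `&` M1t Z g1 g2 t @^-1` [set m]) /
  pr P (M1t Z g1 g2 t @^-1` [set m]) = normalize (unnormalized_filter Z m) x.
Proof.
move=> tT; rewrite state_memory_prob// memory_prob// /joint -mulr_sumr.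
by case: compatible; rewrite ?mul0r ?eqxx// !mul1r.
Qed.

Definition belief_rule t (m2 : mem2 S t) (pi : Delta R (X S t)) : U1 S t :=
  belief_action m2 pi.

Lemma belief_strategy_structural :
  structural_form1 Z belief_strategy g2 belief_rule.
Proof.
move=> t tT; have := ae_memory_prob_neq0 belief_strategy t.
apply: filterS => z; set m := M1t _ _ _ _ z => pm.
have post := posterior_normalize _ tT pm.
pose a := normalize (unnormalized_filter Z m).
have a0 x : 0 <= a x by rewrite /a -post divr_ge0// pr_ge0.
have a1 : \sum_x a x = 1.
  under eq_bigr do rewrite /a -post state_memory_prob//.
  by rewrite -mulr_suml -memory_prob// divff.
exists (MkDelta a0 a1); split=> [M x|//].
exact/esym/post.
Qed.

End DynamicProgramming.

Theorem theorem1 (R : realType) (S : team R) (U1_inhabited : forall t, 0 < #|U1 S t|)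
    (d : measure_display) (Omega : measurableType d) (P : probability Omega R)
    (Z : primitives S P) (g2 : strategy2 S) :
  exists (gamma : forall t, mem2 S t -> Delta R (X S t) -> U1 S t)
         (g1 : strategy1 S),
    optimal1 Z g2 g1 /\ structural_form1 Z g1 g2 gamma.
Proof.
exists (@belief_rule R S U1_inhabited d Omega P Z g2).
exists (@belief_strategy R S U1_inhabited d Omega P Z g2).
split; [exact: belief_strategy_optimal|exact: belief_strategy_structural].
Qed.
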